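(* Let $\mathcal K=(\mathcal T,\mathcal A)$ be a satisfiable DL-Lite$_{core}$ knowledge base with canonical model $\mathcal C_{\mathcal K}$, and let $q$ be an exhaustive rooted CCQ. Then the certain answers to $q$ w.r.t. $\mathcal K$ coincide with the answer intervals for $q$ in $\mathcal C_{\mathcal K}$; that is, for every tuple $\mathbf a$ of individuals of $\mathcal A$ (of the length of the answer tuple of $q$) and every integer $m$, $(\mathbf a,[m,+\infty])$ is an answer interval for $q$ in every model of $\mathcal K$ if and only if it is an answer interval for $q$ in $\mathcal C_{\mathcal K}$.
   Context: Description logic: let $N_C$, $N_R$, $N_I$ be pairwise disjoint infinite sets of atomic concepts, atomic roles and individual names. A role is $P$ or $P^-$ with $P\in N_R$; $R^-$ denotes $P^-$ if $R=P$ and $P$ if $R=P^-$. An ABox $\mathcal A$ is a finite set of assertions $A(b)$, $P(a,b)$ ($A\in N_C$, $P\in N_R$, $a,b\in N_I$); $\mathsf{Ind}(\mathcal A)$ is the set of individuals occurring in it; $P^-(a,b)\in\mathcal A$ means $P(b,a)\in\mathcal A$. A DL-Lite$_{core}$ TBox is a finite set of concept inclusions $B_1\sqsubseteq B_2$ or $B_1\sqsubseteq\neg B_2$, where each $B_i$ is some $A\in N_C$ or $\exists R$ with $R$ a role. A knowledge base (KB) is a pair $\mathcal K=(\mathcal T,\mathcal A)$ of a TBox and an ABox. An interpretation $\mathcal I$ has a non-empty domain $\Delta^{\mathcal I}$ and maps each $A\in N_C$ to $A^{\mathcal I}\subseteq\Delta^{\mathcal I}$, each $P\in N_R$ to $P^{\mathcal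 I}\subseteq\Delta^{\mathcal I}\times\Delta^{\mathcal I}$, and individuals injectively to domain elements (unique name assumption); $(P^-)^{\mathcal I}$ is the converse of $P^{\mathcal I}$, $(\exists R)^{\mathcal I}=\{d\mid \exists d'\,(d,d')\in R^{\mathcal I}\}$, and $\neg$ is complement. $\mathcal I$ is a model of $\mathcal K$ if $F^{\mathcal I}\subseteq G^{\mathcal I}$ for every inclusion $F\sqsubseteq G$ in $\mathcal T$ and all assertions of $\mathcal A$ hold in $\mathcal I$; $\mathcal K$ is satisfiable if it has a model; $\models$ denotes entailment. Canonical model: $\mathcal C_{\mathcal K}$ has as domain $\mathsf{Ind}(\mathcal A)$ together with all words $aR_1\dots R_n$ ($n\ge1$, $a\in\mathsf{Ind}(\mathcal A)$, $R_i$ roles) such that $\mathcal K\models\exists R_1(a)$, there is no $b$ with $R_1(a,b)\in\mathcal A$, and for $1\le i<n$, $\mathcal T\models\exists R_i^-\sqsubseteq\exists R_{i+1}$ and $R_i^-\ne R_{i+1}$. Individuals of $\mathcal A$ are interpreted as themselves; $A^{\mathcal C_{\mathcal K}}=\{a\in\mathsf{Ind}(\mathcal A)\mid\mathcal K\models A(a)\}\cup\{aR_1\dots R_n\mid n\ge 1,\ \mathcal T\models\exists R_n^-\sqsubseteq A\}$; $P^{\mathcal C_{\mathcal K}}=\{(a,b)\mid P(a,b)\in\mathcal A\}\cup\{(e_1,e_2)\mid e_2=e_1R,\ \mathcal T\models R\sqsubseteq P\}\cup\{(e_2,e_1)\mid e_2=e_1R,\ \mathcal T\models R\sqsubseteq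 P^-\}$. Counting queries: a counting conjunctive query (CCQ) is $q(\mathbf x)=\exists\mathbf y\,\exists\mathbf z\;\psi(\mathbf x,\mathbf y,\mathbf z)$, where $\mathbf x$ (answer variables), $\mathbf y$ (existential variables), $\mathbf z$ (counting variables) are disjoint tuples of variables and $\psi$ is a conjunction of atoms $A(t)$, $P(t_1,t_2)$ whose terms are individual names or variables from $\mathbf x\cup\mathbf y\cup\mathbf z$. A match of $q$ in $\mathcal I$ is a map $\sigma$ from the terms of $q$ to $\Delta^{\mathcal I}$ with $\sigma(a)=a^{\mathcal I}$ for individuals $a$, and satisfying all atoms of $\psi$. If $\sigma$ maps $\mathbf x$ to $\mathbf a^{\mathcal I}$, its restriction to $\mathbf z$ is a counting match (c-match) of $q(\mathbf a)$ in $\mathcal I$. $(\mathbf a,[m,+\infty])$ is an answer interval for $q$ in $\mathcal I$ if the number of distinct c-matches of $q(\mathbf a)$ in $\mathcal I$ is at least $m$; it is a certain answer w.r.t. $\mathcal K$ if this holds in every model of $\mathcal K$. $q$ is exhaustive if it has no existential variables ($\mathbf y=\emptyset$). The Gaifman graph of $q$ has the terms of $q$ as vertices and an edge $\{t_1,t_2\}$ iff $t_1,t_2$ co-occur in a role atom; $q$ is rooted if every connected component of its Gaifman graph contains at least one answer variable or individual name. *)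

(* Defs.v *)
From Stdlib Require Import Relation_Operators.
From mathcomp Require Import all_boot all_order ssralg ssrint.
From mathcomp Require Import boolp classical_sets functions cardinality.

Set Implicit Arguments.
Unset Strict Implicit.
Unset Printing Implicit Defensive.

Local Open Scope classical_set_scope.
Local Open Scope card_scope.

(* Atomic concepts, atomic roles, individual names and variables are taken from
   four types NC, NR, NI and V, so these sets are automatically disjoint. *)

Section Syntax.
Variables NC NR NI : Type.

Inductive role := Dir of NR | Inv of NR.

Definition inv_role (R : role) : role :=
  match R with Dir P => Inv P | Inv P => Dir P end.

Inductive basic := Atomic of NC | Exists of role.

Inductive concept := Pos of basic | Neg of basic.

Record inclusion := Inclusion { lhs : basic; rhs : concept }.

Inductive assertion := CAssert of NC & NI | RAssert of NR & NI & NI.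

Record kb := KB {
  tbox : set inclusion;
  abox : set assertion;
  tbox_finite : finite_set tbox;
  abox_finite : finite_set abox }.

Definition role_assertion (A : set assertion) (R : role) (a b : NI) : Prop :=
  match R with
  | Dir P => A (RAssert P a b)
  | Inv P => A (RAssert P b a)
  end.

Definition Ind (A : set assertion) : set NI :=
  [set a | (exists C, A (CAssert C a)) \/
           (exists P b, A (RAssert P a b) \/ A (RAssert P b a))].

End Syntax.

Section Structures.
Variables NC NR NI : Type.

(* The canonical model interprets only the individuals of the ABox, and its
   domain is empty when the ABox is. A structure may therefore leave individual
   names uninterpreted ([None]) and have an empty domain; an interpretation is a
   structure satisfying [is_interpretation]. *)
Record structure := Structure {
  dom :> Type;
  cint : NC -> set dom;
  rint : NR -> set (dom * dom);
  iint : NI -> option dom }.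

End Structures.

Arguments cint {NC NR NI} s _ _.
Arguments rint {NC NR NI} s _ _.
Arguments iint {NC NR NI} s _.

Section Semantics.
Variables NC NR NI : Type.
Notation structure := (structure NC NR NI).

Definition is_interpretation (I : structure) : Prop :=
  [/\ [set: I] !=set0,
      (forall a, exists d, iint I a = Some d) &
      injective (iint I)].

Definition role_ext (I : structure) (R : role NR) : set (I * I) :=
  match R with
  | Dir P => rint I P
  | Inv P => [set de | rint I P (de.2, de.1)]
  end.

Arguments role_ext : clear implicits.

Definition basic_ext (I : structure) (B : basic NC NR) : set I :=
  match B with
  | Atomic A => cint I A
  | Exists R => [set d | exists d', role_ext I R (d, d')]
  end.

Arguments basic_ext : clear implicits.

Definition concept_ext (I : structure) (C : concept NC NR) : set I :=
  match C with
  | Pos B => basic_ext I B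
  | Neg B => ~` basic_ext I B
  end.

Arguments concept_ext : clear implicits.

Definition sat_inclusion (I : structure) (i : inclusion NC NR) : Prop :=
  basic_ext I (lhs i) `<=` concept_ext I (rhs i).

Definition sat_assertion (I : structure) (f : assertion NC NR NI) : Prop :=
  match f with
  | CAssert A a => exists2 d, iint I a = Some d & cint I A d
  | RAssert P a b =>
      exists d e, [/\ iint I a = Some d, iint I b = Some e & rint I P (d, e)]
  end.

Definition tbox_model (T : set (inclusion NC NR)) (I : structure) : Prop :=
  is_interpretation I /\ forall i, T i -> sat_inclusion I i.

Definition model (K : kb NC NR NI) (I : structure) : Prop :=
  tbox_model (tbox K) I /\ forall f, abox K f -> sat_assertion I f.

Definition satisfiable (K : kb NC NR NI) : Prop := exists I, model K I.

Definition entails_inclusion (T : set (inclusion NC NR)) (B1 B2 : basic NC NR) :=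
  forall I, tbox_model T I -> sat_inclusion I (Inclusion B1 (Pos B2)).

Definition entails_role_inclusion (T : set (inclusion NC NR)) (R S : role NR) :=
  forall I, tbox_model T I -> role_ext I R `<=` role_ext I S.

Definition entails_assertion (K : kb NC NR NI) (B : basic NC NR) (a : NI) :=
  forall I, model K I -> exists2 d, iint I a = Some d & basic_ext I B d.

End Semantics.

Section CanonicalModel.
Variables (NC NR NI : Type) (K : kb NC NR NI).
Local Notation T := (tbox K).
Local Notation A := (abox K).

Definition can_follow (R S : role NR) : Prop :=
  entails_inclusion NI T (Exists NC (inv_role R)) (Exists NC S) /\
  inv_role R <> S.

(* The word a R_1 ... R_n is encoded as (a, [:: R_1; ...; R_n]). *)
Definition canon_word : set (NI * seq (role NR)) :=
  [set u | Ind A u.1 /\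
    match u.2 with
    | [::] => True
    | R1 :: w =>
        [/\ entails_assertion K (Exists NC R1) u.1,
            ~ (exists b, role_assertion A R1 u.1 b) &
            path (fun R S => `[< can_follow R S >]) R1 w]
    end].

(* [succ_word e1 R e2]: the word e2 is e1 R. *)
Definition succ_word (e1 : canon_word) (R : role NR) (e2 : canon_word) : Prop :=
  val e2 = ((val e1).1, rcons (val e1).2 R).

Definition canon_cint (C : NC) : set canon_word :=
  [set e | (exists2 a, val e = (a, [::]) & entails_assertion K (Atomic NR C) a) \/
           (exists a w R, val e = (a, rcons w R) /\
              entails_inclusion NI T (Exists NC (inv_role R)) (Atomic NR C))].

Definition canon_rint (P : NR) : set (canon_word * canon_word) :=
  [set e | exists a b, [/\ val e.1 = (a, [::]), val e.2 = (b, [::]) &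
                           A (RAssert NC P a b)]] `|`
  [set e | exists2 R, succ_word e.1 R e.2 &
                      entails_role_inclusion NI T R (Dir P)] `|`
  [set e | exists2 R, succ_word e.2 R e.1 &
                      entails_role_inclusion NI T R (Inv P)].

(* [insub] returns [Some] exactly when a belongs to Ind A. *)
Definition canonical_model : structure NC NR NI :=
  Structure canon_cint canon_rint (fun a => insub (a, [::])).

End CanonicalModel.

Section Queries.
Variables (NC NR NI : Type) (V : eqType).

Inductive term := TInd of NI | TVar of V.

Inductive atom := CAtom of NC & term | RAtom of NR & term & term.

Definition atom_has_term (g : atom) (t : term) : Prop :=
  match g with
  | CAtom _ t1 => t = t1
  | RAtom _ t1 t2 => t = t1 \/ t = t2
  end.

Record ccq := CCQ {
  arity : nat;
  avars : arity.-tuple V;   (* answer variables x *)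
  evars : seq V;            (* existential variables y *)
  cvars : seq V;            (* counting variables z *)
  body : set atom;
  body_finite : finite_set body;
  avars_evars_disj : {in avars, forall v, v \notin evars};
  avars_cvars_disj : {in avars, forall v, v \notin cvars};
  evars_cvars_disj : {in evars, forall v, v \notin cvars};
  body_vars : forall g v, body g -> atom_has_term g (TVar v) ->
    [|| v \in avars, v \in evars | v \in cvars] }.

(* The quantified and answer variables are terms of the query even when they
   occur in no atom. *)
Definition terms (q : ccq) : set term :=
  [set t | (exists2 g, body q g & atom_has_term g t) \/
           (exists2 v, t = TVar v &
              [|| v \in avars q, v \in evars q | v \in cvars q])].

Definition exhaustive (q : ccq) : Prop := evars q = [::].

Definition gaifman_edge (q : ccq) (t1 t2 : term) : Prop :=
  exists P, body q (RAtom P t1 t2) \/ body q (RAtom P t2 t1).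

Definition rooted (q : ccq) : Prop :=
  forall t, terms q t -> exists t',
    [/\ terms q t', clos_refl_trans term (gaifman_edge q) t t' &
        (exists2 v, t' = TVar v & v \in avars q) \/ (exists a, t' = TInd a)].

Definition is_match (q : ccq) (I : structure NC NR NI) (s : terms q -> I) : Prop :=
  [/\ forall (t : terms q) a, val t = TInd a -> iint I a = Some (s t),
      forall C (t : terms q), body q (CAtom C (val t)) -> cint I C (s t) &
      forall P (t1 t2 : terms q),
        body q (RAtom P (val t1) (val t2)) -> rint I P (s t1, s t2)].

Definition cmatches (q : ccq) (I : structure NC NR NI)
    (a : (arity q).-tuple NI) : set ({v : V | v \in cvars q} -> I) :=
  [set c | exists s : terms q -> I,
    [/\ is_match s,
        forall (i : 'I_(arity q)) (t : terms q),
          val t = TVar (tnth (avars q) i) -> iint I (tnth a i) = Some (s t) &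
        forall v (t : terms q), val t = TVar (val v) -> c v = s t]].

Arguments cmatches : clear implicits.

(* (a, [m, +oo]) is an answer interval for q in I; the condition is void for a
   negative integer m. *)
Definition answer_interval (q : ccq) (I : structure NC NR NI)
    (a : (arity q).-tuple NI) (m : int) : Prop :=
  match m with
  | Posz n => `I_n #<= cmatches q I a
  | Negz _ => True
  end.

Arguments answer_interval : clear implicits.

Definition certain_answer (q : ccq) (K : kb NC NR NI)
    (a : (arity q).-tuple NI) (m : int) : Prop :=
  forall I, model K I -> answer_interval q I a m.

End Queries.

Arguments answer_interval {NC NR NI V} q I a m.
Arguments certain_answer {NC NR NI V} q K a m.

(* Main.v *)
(** Every model I of K receives a homomorphism from the canonical model C, and
    composing with it sends c-matches in C to c-matches in I. The homomorphism
    need not be injective, but this composition is: the S-neighbours of an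
    element of C are either all individuals of the ABox, which stay distinct by
    the unique name assumption, or there is at most one of them. Hence two
    matches in C with the same image agree along every Gaifman path issued from
    a root. Conversely, C becomes a model of K once isolated elements are added
    to interpret the individual names outside the ABox; a rooted exhaustive
    query maps no term to an isolated element, so it has the same c-matches. *)
Require Import Defs.
From Stdlib Require Import Relation_Operators.
From mathcomp Require Import all_boot all_order ssralg ssrint.
From mathcomp Require Import boolp classical_sets functions cardinality.

Local Open Scope classical_set_scope.

Local Notation Inv := Defs.Inv.

Lemma inv_roleK {NR : Type} (R : role NR) : inv_role (inv_role R) = R.
Proof. by case: R. Qed.

Lemma role_ext_inv {NC NR NI : Type} (I : structure NC NR NI) (R : role NR)
    (d e : I) : role_ext (I := I) (inv_role R) (d, e) <-> role_ext (I := I) R (e, d).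
Proof. by case: R. Qed.

(** * Role inclusions entailed by a TBox *)

Section RoleInclusion.
Context {NC NR NI : Type}.

Definition shift (P Q : NR) : int := if `[< Q = P >] then 1%R else 0%R.

Definition role_shift (P : NR) (R : role NR) : int :=
  match R with Dir Q => shift P Q | Inv Q => (- shift P Q)%R end.

(* Unfolding a model along the integers, with P alone moving the second
   component, separates P from every other role without changing the basic
   concepts of the first component. *)
Definition unfolding (P : NR) (I : structure NC NR NI) : structure NC NR NI :=
  Structure (dom := (I * int)%type)
    (fun C => [set x | cint I C x.1])
    (fun Q => [set x | rint I Q (x.1.1, x.2.1) /\
                       x.2.2 = (x.1.2 + shift P Q)%R])
    (fun a => omap (fun d => (d, 0%R)) (iint I a)).

Lemma unfolding_role P (I : structure NC NR NI) R (x y : unfolding P I) :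
  role_ext (I := unfolding P I) R (x, y) <->
  role_ext (I := I) R (x.1, y.1) /\ y.2 = (x.2 + role_shift P R)%R.
Proof.
case: x y => d i [e j]; case: R => Q //=; split=> -[? H]; split=> //;
  by rewrite H ?GRing.addrK ?GRing.subrK.
Qed.

Lemma unfolding_basic P (I : structure NC NR NI) B (x : unfolding P I) :
  basic_ext (I := unfolding P I) B x <-> basic_ext (I := I) B x.1.
Proof.
case: B => [//|R]; split=> [[y /unfolding_role[H _]]|[e H]]; first by exists y.1.
by exists (e, (x.2 + role_shift P R)%R); apply/unfolding_role.
Qed.

Lemma unfolding_model P (T : set (inclusion NC NR)) (I : structure NC NR NI) :
  tbox_model T I -> tbox_model T (unfolding P I).
Proof.
move=> [[[d0 _] Itot Iinj] IT]; split; last first.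
  move=> [B [B'|B']] /IT H x /unfolding_basic /H //= H'.
    exact/unfolding_basic.
  by move/unfolding_basic.
split.
- by exists (d0, 0%R).
- by move=> a; have [d E] := Itot a; exists (d, 0%R); rewrite /= E.
- move=> a b /=; have [[d Ea] [e Eb]] := (Itot a, Itot b).
  by rewrite Ea Eb => -[E]; apply: Iinj; rewrite Ea Eb E.
Qed.

(** Let [P] be the atomic role of [S]. The unfolding lifts the [R]-edge to one from height 0 to
    height [role_shift P R]. As it is also an [S]-edge, this height is the shift of [S], namely 1 or
    -1. A nonzero shift determines the role, its sign telling [P] from its inverse. *)
Lemma role_inclusion_eq {T : set (inclusion NC NR)} {I : structure NC NR NI}
    {R S : role NR} {d e : I} :
  tbox_model T I -> role_ext (I := I) R (d, e) ->
  entails_role_inclusion NI T R S -> R = S.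
Proof.
move=> IT Rde TRS; set P := match S with Dir P => P | Inv P => P end.
have : role_ext (I := unfolding P I) R ((d, 0%R), (e, role_shift P R)).
  by apply/unfolding_role; rewrite /= GRing.add0r.
move=> /(TRS _ (unfolding_model P T I IT)) /unfolding_role [_ /=].
rewrite GRing.add0r /P /role_shift /shift.
case: R {Rde TRS} => Q; case: {P} S => P; rewrite (asboolT (erefl P));
  by case: asboolP => // ->.
Qed.

End RoleInclusion.

(** * Words of the canonical model and the concepts entailed at them *)

Section Canonical.
Context {NC NR NI : Type}.
Variable K : kb NC NR NI.
Local Notation T := (tbox K).
Local Notation A := (abox K).
Local Notation C := (canonical_model K).
Local Notation word := (canon_word K).

Lemma word_belast {a w R} : word (a, rcons w R) -> word (a, w).
Proof.
case: w => [|S w] [/= Ia]; first by [].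
by rewrite rcons_path => -[HS nS /andP[? _]].
Qed.

Lemma word_follow {a w R S} :
  word (a, rcons (rcons w R) S) -> can_follow K R S.
Proof.
case: w => [|R1 w] [/= _ [_ _]]; first by rewrite andbT => /asboolP.
by rewrite rcons_path last_rcons => /andP[_ /asboolP].
Qed.

Lemma word_rcons a w R S :
  word (a, rcons w R) -> can_follow K R S -> word (a, rcons (rcons w R) S).
Proof.
case: w => [|R1 w] [/= Ia [HR nR p]] RS; split=> //=; split=> //.
  by rewrite andbT; apply/asboolP.
by rewrite rcons_path p last_rcons; apply/asboolP.
Qed.

Lemma wordP (e : word) : word (val e).
Proof. exact: set_mem (valP e). Qed.

Lemma mk_word u : word u -> exists e : word, val e = u.
Proof. by move=> /mem_set Wu; exists (Sub u Wu). Qed.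

Lemma word_cases (e : word) :
  (exists a, val e = (a, [::])) \/ (exists a w R, val e = (a, rcons w R)).
Proof.
case: (val e) => a; elim/last_ind => [|w R _]; first by left; exists a.
by right; exists a, w, R.
Qed.

Lemma canon_iint (e : word) a : iint C a = Some e <-> val e = (a, [::]).
Proof.
split=> /= [|E]; first by case: insubP => // u _ Eu [<-].
by rewrite -E valK.
Qed.

(* For an anonymous element the concept is entailed by the TBox alone, from the
   last role of the word. *)
Definition entails_at (e : word) (B : basic NC NR) : Prop :=
  (exists2 a, val e = (a, [::]) & entails_assertion K B a) \/
  (exists a w R, val e = (a, rcons w R) /\
     entails_inclusion NI T (Exists NC (inv_role R)) B).

Lemma entails_at_trans (e : word) B1 B2 :
  entails_at e B1 -> entails_inclusion NI T B1 B2 -> entails_at e B2.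
Proof.
move=> [[a Ee KB]|[a [w [R [Ee TB]]]]] B12; [left; exists a => //|right].
  by move=> I IK; have [d Ed /(B12 I IK.1)] := KB I IK; exists d.
by exists a, w, R; split=> // I IT d /(TB I IT) /(B12 I IT).
Qed.

Lemma entails_at_succ (e1 e2 : word) R :
  succ_word e1 R e2 -> entails_at e1 (Exists NC R).
Proof.
rewrite /succ_word => E; have := wordP e2; rewrite {}E.
have [[a Ee]|[a [w [R0 Ee]]]] := word_cases e1; rewrite Ee /= => We2.
  by left; exists a => //; case: We2 => /= _ [].
by right; exists a, w, R0; split=> //; case: (word_follow We2).
Qed.

Lemma entails_at_pred (e1 e2 : word) R :
  succ_word e1 R e2 -> entails_at e2 (Exists NC (inv_role R)).
Proof. by move=> E; right; exists (val e1).1, (val e1).2, R; split=> // J _ d. Qed.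

(** * Homomorphisms from the canonical model into models *)

Definition hom (I : structure NC NR NI) (f : word -> I) : Prop :=
  (forall e a, val e = (a, [::]) -> iint I a = Some (f e)) /\
  (forall e1 R e2, succ_word e1 R e2 -> role_ext (I := I) R (f e1, f e2)).

(** For a word ending in [R], the image of its prefix is an [R]-predecessor of the image of the
    word. The latter thus lies in the concept from which the TBox derives [B]. *)
Lemma hom_entails_at I f : model K I -> hom I f ->
  forall e B, entails_at e B -> basic_ext (I := I) B (f e).
Proof.
move=> IK [f_ind f_succ] e B [[a Ee KB]|[a [w [R [Ee TB]]]]].
  by have [d] := KB I IK; rewrite (f_ind _ _ Ee) => -[<-].
have [|e1 E1] := mk_word (a, w).
  by apply: (@word_belast _ _ R); rewrite -Ee; apply: wordP.
apply: (TB I IK.1); exists (f e1); apply/role_ext_inv/f_succ.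
by rewrite /succ_word E1.
Qed.

(** A word is mapped by iterating a chosen successor function from the element named by its
    individual. The required successor exists: for the first role by entailment from the KB, for a
    later one because the preceding edge, read backwards, triggers [can_follow]. *)
Lemma hom_exists I : model K I -> exists f, hom I f.
Proof.
move=> IK; have [[_ Itot _] IT] := IK.1.
have [i0 i0E] := choice Itot.
have /choice[nxt nxtP] : forall dR : I * role NR, exists d',
    basic_ext (I := I) (Exists NC dR.2) dR.1 -> role_ext (I := I) dR.2 (dR.1, d').
  move=> [d R] /=.
  (* If [d] has no [R]-successor, [d] itself serves as a default value. *)
  by case: (pselect (exists d', role_ext (I := I) R (d, d')))
    => [[d' H]|H]; [exists d' | exists d].
pose g (u : NI * seq (role NR)) := foldl (fun d R => nxt (d, R)) (i0 u.1) u.2.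
have {}nxtP d R : (exists d', role_ext (I := I) R (d, d')) ->
    role_ext (I := I) R (d, nxt (d, R)) by exact: (nxtP (d, R)).
have gS a w R : g (a, rcons w R) = nxt (g (a, w), R) by rewrite /g foldl_rcons.
have gP a w R : word (a, rcons w R) ->
    role_ext (I := I) R (g (a, w), g (a, rcons w R)).
  elim/last_ind: w R => [|w R0 IH] R W;
    rewrite [g (a, rcons _ R)]gS; apply: nxtP.
    by case: W => /= _ [/(_ I IK)[d]]; rewrite /g /= i0E => -[<-].
  have [+ _] := word_follow W; apply; first exact: IK.1.
  exists (g (a, w)); apply/role_ext_inv/IH; exact: word_belast W.
exists (fun e => g (val e)); split=> [e a ->|e1 R e2 E]; first exact: i0E.
have := wordP e2; rewrite E => /gP; by case: (val e1).
Qed.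

(** * Roles and concepts in the canonical model *)

Hypothesis K_sat : satisfiable K.

(* In the disjuncts defining [canon_rint] the entailed role inclusions are
   trivial, since the role R is nonempty in some model of K. *)
Lemma canon_role (S : role NR) (e1 e2 : C) :
  role_ext (I := C) S (e1, e2) <->
  [\/ exists a b, [/\ val e1 = (a, [::]), val e2 = (b, [::]) &
                      role_assertion A S a b],
      succ_word e1 S e2 | succ_word e2 (inv_role S) e1].
Proof.
have [I IK] := K_sat; have [f [_ f_succ]] := hom_exists I IK.
have succ_eq (x y : word) R R' :
    succ_word x R y -> entails_role_inclusion NI T R R' -> R = R'.
  by move=> /f_succ H RR'; exact: role_inclusion_eq IK.1 H RR'.
have succ_refl (R : role NR) : entails_role_inclusion NI T R R by move=> J _ d.
have canon_rintE P (x y : C) : rint C P (x, y) <->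
    [\/ exists a b, [/\ val x = (a, [::]), val y = (b, [::]) &
                        A (RAssert NC P a b)],
        succ_word x (Dir P) y | succ_word y (Inv P) x].
  split=> /= [[[H|[R E /(succ_eq _ _ _ _ E)ER]]|[R E /(succ_eq _ _ _ _ E)ER]]|].
  - exact: Or31.
  - by apply: Or32; rewrite -ER.
  - by apply: Or33; rewrite -ER.
  - by case=> H; [left; left|left; right; exists (Dir P)|right; exists (Inv P)].
case: S => P /=; first exact: canon_rintE.
split=> [/canon_rintE|H]; last apply/canon_rintE.
  by move=> [[a [b [? ? ?]]]|?|?]; [apply: Or31; exists b, a|apply: Or33|apply: Or32].
by move: H=> [[a [b [? ? ?]]]|?|?];
  [apply: Or31; exists b, a|apply: Or33|apply: Or32].
Qed.

(** An [S]-neighbour is an ABox neighbour, the successor word or the predecessor word, and the last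
    two are unique. No two kinds coexist: an ABox edge forbids the successor of an individual, an
    individual has no predecessor, and [can_follow] forbids a role followed by its inverse. *)
Lemma canon_neighbour (S : role NR) (e e1 e2 : C) :
  role_ext (I := C) S (e, e1) -> role_ext (I := C) S (e, e2) ->
  e1 = e2 \/ exists a b, val e1 = (a, [::]) /\ val e2 = (b, [::]).
Proof.
have ind_succ (x y x' : word) a b : val x = (a, [::]) ->
    role_assertion A S a b -> succ_word x S x' -> False.
  move=> Ex Sab; rewrite /succ_word Ex => E.
  by have := wordP x'; rewrite E => -[_ /= [_ + _]]; apply; exists b.
have ind_pred (x x' : word) a : val x = (a, [::]) ->
    succ_word x' (inv_role S) x -> False.
  by rewrite /succ_word => -> [_]; case: (val x').2.
have succ_pred (x x1 x2 : word) :
    succ_word x S x1 -> succ_word x2 (inv_role S) x -> False.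
  rewrite /succ_word => E1 E2; have := wordP x1; rewrite E1 E2 /=.
  by move=> /word_follow[_]; rewrite inv_roleK.
move=> /canon_role[[a [b [Ea Eb Sab]]]|E1|E1]
       /canon_role[[a' [b' [Ea' Eb' Sab']]]|E2|E2].
- by right; exists b, b'.
- by case: (ind_succ _ e1 _ _ _ Ea Sab E2).
- by case: (ind_pred _ _ _ Ea E2).
- by case: (ind_succ _ e1 _ _ _ Ea' Sab' E1).
- by left; apply: val_inj; rewrite E1 E2.
- by case: (succ_pred _ _ _ E1 E2).
- by case: (ind_pred _ _ _ Ea' E1).
- by case: (succ_pred _ _ _ E2 E1).
- left; apply: val_inj; move: E1; rewrite /succ_word E2.
  by case: (val e1) (val e2) => [x u] [y v] /= [-> /rcons_inj[->]].
Qed.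

(** When the restrictions on words exclude the successor word as a witness for an entailed
    existential, they supply another one: an ABox neighbour, or the predecessor if [S] inverts the
    last role. *)
Lemma canon_basic B (e : C) : basic_ext (I := C) B e <-> entails_at e B.
Proof.
case: B => [D|S]; first by split.
split=> [[e' /canon_role[[a [b [Ea Eb Sab]]]|E|E]]|].
- left; exists a => // I [_ IA].
  by case: S Sab => P /IA /= [d [d' [Ed Ed' H]]];
    [exists d => //; exists d'|exists d' => //; exists d].
- exact: entails_at_succ E.
- by rewrite -[S]inv_roleK; apply: entails_at_pred E.
move=> [[a Ee KS]|[a [w [R [Ee TS]]]]].
  have Ia : word (a, [::]) by rewrite -Ee; apply: wordP.
  have [[b Sab]|nS] := pselect (exists b, role_assertion A S a b).
    have [|e' Ee'] := mk_word (b, [::]).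
      by split=> //=; right; case: S Sab {KS} => P Sab; exists P, a; [right|left].
    by exists e'; apply/canon_role/Or31; exists a, b.
  have [|e' Ee'] := mk_word (a, [:: S]); first by split=> //; case: Ia.
  by exists e'; apply/canon_role/Or32; rewrite /succ_word Ee.
have We : word (a, rcons w R) by rewrite -Ee; apply: wordP.
have [RS|RS] := pselect (inv_role R = S).
  have [e' Ee'] := mk_word _ (word_belast We).
  by exists e'; apply/canon_role/Or33; rewrite /succ_word Ee' -RS inv_roleK.
have [|e' Ee'] := mk_word (a, rcons (rcons w R) S); first exact: word_rcons.
by exists e'; apply/canon_role/Or32; rewrite /succ_word Ee.
Qed.

(** * Completion of the canonical model to a model of the KB *)

Definition completion : structure NC NR NI :=
  Structure (dom := (word + NI)%type)
    (fun D => [set x | exists2 e, x = inl e & cint C D e])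
    (fun P => [set x | exists e1 e2, x = (inl e1, inl e2) /\ rint C P (e1, e2)])
    (fun a => Some (if iint C a is Some e then inl e else inr a)).

Lemma completion_role R (x y : completion) : role_ext (I := completion) R (x, y) <->
  exists e1 e2, [/\ x = inl e1, y = inl e2 & role_ext (I := C) R (e1, e2)].
Proof.
case: R => P; split=> /=.
- by move=> [e1 [e2 [[-> ->]]]]; exists e1, e2.
- by move=> [e1 [e2 [-> ->]]]; exists e1, e2.
- by move=> [e1 [e2 [[-> ->]]]]; exists e2, e1.
- by move=> [e1 [e2 [-> ->]]]; exists e2, e1.
Qed.

Lemma completion_basic B (x : completion) : basic_ext (I := completion) B x <->
  exists2 e, x = inl e & basic_ext (I := C) B e.
Proof.
case: B => [//|R]; split=> /=.
  by move=> [y /completion_role[e1 [e2 [-> _ H]]]]; exists e1 => //; exists e2.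
move=> [e -> [e' H]]; exists (inl e'); apply/completion_role; by exists e, e'.
Qed.

(** Isolated elements lie in no basic concept, so inclusions hold vacuously there. On words,
    positive inclusions follow by composing entailments; [a0] inhabits the domain even if the ABox
    is empty. *)
Lemma completion_model (a0 : NI) : model K completion.
Proof.
have [I IK] := K_sat; have [f f_hom] := hom_exists I IK.
have ind a : Ind A a -> exists e : C, val e = (a, [::]).
  by move=> Ia; apply: mk_word; split.
split; first split; first split.
- by exists (inr a0).
- by move=> a; eexists.
- move=> a b [].
  case Ea: (insub _) => [e|]; case Eb: (insub _) => [e'|] // [].
    move=> E; move: Ea Eb; rewrite E => /canon_iint Ea /canon_iint.
    by rewrite Ea => -[].
  by [].
- move=> [B1 [B2|B2]] Ti x /completion_basic[e -> /canon_basic Be] /=.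
    apply/completion_basic; exists e => //; apply/canon_basic.
    by apply: entails_at_trans Be _ => J [_ /(_ _ Ti)].
  (* A violated disjointness at [e] would be carried by [f] to the model [I]. *)
  move=> /completion_basic[_ [<-] /canon_basic Be'].
  have [_ /(_ _ Ti) neg] := IK.1.
  by apply: (neg (f e)); apply: hom_entails_at.
move=> [D a|P a b] Af /=.
  have [|e Ee] := ind a; first by left; exists D.
  have -> : insub (a, [::]) = Some e by apply/canon_iint.
  exists (inl e) => //; exists e => //; left; exists a => //.
  by move=> J [_ /(_ _ Af)].
have [|e Ee] := ind a; first by right; exists P, b; left.
have [|e' Ee'] := ind b; first by right; exists P, a; right.
have -> : insub (a, [::]) = Some e by apply/canon_iint.
have -> : insub (b, [::]) = Some e' by apply/canon_iint.
exists (inl e), (inl e'); split=> //; exists e, e'; split=> //.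
by left; left; exists a, b.
Qed.

End Canonical.

(** * Comparison of counting matches *)

Section Matches.
Local Open Scope card_scope.
Context {NC NR NI : Type} {V : eqType}.
Variables (K : kb NC NR NI) (q : ccq NC NR NI V) (a : (arity q).-tuple NI).
Hypotheses (K_sat : satisfiable K) (q_exhaustive : exhaustive q)
  (q_rooted : rooted q).
Local Notation C := (canonical_model K).

Lemma mk_term t : terms q t -> exists x : terms q, val x = t.
Proof. by move=> /mem_set Wt; exists (Sub t Wt). Qed.

Lemma termP (t : terms q) : terms q (val t).
Proof. exact: set_mem (valP t). Qed.

Lemma exhaustive_terms (t : terms q) :
  [\/ exists b, val t = TInd _ b,
      exists i : 'I_(arity q), val t = TVar _ (tnth (avars q) i) |
      exists v : {v : V | v \in cvars q}, val t = TVar _ (val v)].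
Proof.
case Et: (val t) => [b|v]; first by apply: Or31; exists b.
have : [|| v \in avars q, v \in evars q | v \in cvars q].
  case: (termP t) => [[g qg]|[w]]; rewrite Et; last by case=> ->.
  exact: body_vars qg.
rewrite q_exhaustive /= => /orP[/tnthP[i ->]|vc]; first by apply: Or32; exists i.
by apply: Or33; exists (exist _ v vc).
Qed.

Lemma hom_match (I : structure NC NR NI) (f : C -> I) (s : terms q -> C) :
  model K I -> hom K I f -> is_match s -> is_match (f \o s).
Proof.
move=> IK fh [s_ind s_C s_R]; split=> [t b /s_ind /canon_iint|D t /s_C|P t1 t2 /s_R].
- exact: fh.1.
- by move=> H; apply: (hom_entails_at K I f IK fh _ (Atomic NR D)).
- have rE x y : role_ext (I := C) (Dir P) (x, y) -> rint I P (f x, f y).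
    move=> /(canon_role K K_sat)[[b [c [Eb Ec]]]|E|E].
    + move=> /IK.2 /= [d [e [Ed Ee]]].
      by rewrite (fh.1 _ _ Eb) (fh.1 _ _ Ec) in Ed Ee; case: Ed Ee => -> [->].
    + exact: (fh.2 _ _ _ E).
    + exact: (fh.2 _ _ _ E).
  exact: rE.
Qed.

(** Agreement travels from the end [t'] of the path, a root in the application, back to its start
    [t]. *)
Lemma match_path (I : structure NC NR NI) (f : C -> I) (s1 s2 : terms q -> C) :
  model K I -> hom K I f -> is_match s1 -> is_match s2 -> f \o s1 = f \o s2 ->
  forall t t', clos_refl_trans _ (gaifman_edge q) t t' ->
  (forall x : terms q, val x = t' -> s1 x = s2 x) ->
  forall x : terms q, val x = t -> s1 x = s2 x.
Proof.
move=> IK fh [_ _ m1] [_ _ m2] fs t t' tt'.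
elim: tt' => {t t'} [t t' [P tt']|t|t u t' _ IH1 _ IH2] //; last first.
  by move=> /IH2 /IH1.
move=> agree x Ex.
have [y Ey] : exists y : terms q, val y = t'.
  apply: mk_term; left; case: tt' => H; eexists; try exact: H.
    by right.
  by left.
(* [S] is oriented away from [y], where the matches already agree, so that [canon_neighbour]
   applies. *)
have [S S1 S2] : exists2 S, role_ext (I := C) S (s1 y, s1 x)
    & role_ext (I := C) S (s2 y, s2 x).
  rewrite -Ex -Ey in tt'.
  case: tt' => H; [exists (Inv P)|exists (Dir P)];
    by [exact: m1|exact: m2].
rewrite -(agree _ Ey) in S2.
have [//|[b [c [Eb Ec]]]] := canon_neighbour K K_sat _ _ _ _ S1 S2.
have [[_ _ Iinj] _] := IK.1.
have fE : f (s1 x) = f (s2 x) by have := congr1 (@^~ x) fs.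
have bc : b = c by apply: Iinj; rewrite (fh.1 _ _ Eb) (fh.1 _ _ Ec) fE.
by apply: val_inj; rewrite Eb Ec bc.
Qed.

(** By exhaustiveness, a match is determined on all terms by the answer tuple and its c-match. So
    c-matches with equal images under [F] extend to matches with equal images under [f], to which
    [match_path] applies. *)
Lemma cmatches_canon_le (I : structure NC NR NI) :
  model K I -> cmatches (I := C) a #<= cmatches (I := I) a.
Proof.
move=> IK; have [f fh] := hom_exists K I IK.
pose F (c : {v : V | v \in cvars q} -> C) := f \o c.
have F_inj : {in cmatches (I := C) a &, injective F}.
  move=> c1 c2 /set_mem[s1 [m1 s1a s1c]] /set_mem[s2 [m2 s2a s2c]] Fc.
  have [s1i _ _] := m1; have [s2i _ _] := m2.
  have s_ind (t : terms q) b : val t = TInd _ b -> s1 t = s2 t.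
    by move=> Et; apply: Some_inj; rewrite -(s1i _ _ Et) -(s2i _ _ Et).
  have s_ans (t : terms q) i : val t = TVar _ (tnth (avars q) i) -> s1 t = s2 t.
    by move=> Et; apply: Some_inj; rewrite -(s1a _ _ Et) -(s2a _ _ Et).
  have fs : f \o s1 = f \o s2.
    apply: funext => t /=; case: (exhaustive_terms t) => -[].
    - by move=> b /s_ind ->.
    - by move=> i /s_ans ->.
    - move=> v Et; rewrite -(s1c _ _ Et) -(s2c _ _ Et).
      by have := congr1 (@^~ v) Fc.
  apply: funext => v.
  have [|t Et] := mk_term (TVar _ (val v)).
    by right; exists (val v) => //; rewrite (valP v) !orbT.
  rewrite (s1c _ _ Et) (s2c _ _ Et).
  have [t' [qt' tt' root]] := q_rooted _ (termP t).
  apply: (match_path I f s1 s2 IK fh m1 m2 fs _ _ tt' _ t (erefl _)) => x Ex.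
  case: root => [[w Ew /tnthP[i Ei]]|[b Eb]].
    by apply: (s_ans x i); rewrite Ex Ew Ei.
  by apply: (s_ind x b); rewrite Ex.
rewrite -(card_le_eql (inj_card_eq F_inj)); apply: subset_card_le.
move=> _ [c [s [sm sa sc]] <-]; exists (f \o s); split; first exact: hom_match.
- by move=> i t /sa /canon_iint /fh.1.
- by move=> v t /sc E; rewrite /F /= E.
Qed.

Lemma completion_cmatches_le :
  (forall i, Ind (abox K) (tnth a i)) ->
  cmatches (I := (completion K)) a #<= cmatches (I := C) a.
Proof.
move=> a_ind.
(* It suffices that every c-match in the completion factors through [inl]. *)
apply: card_le_trans (card_image_le (fun c v => inl (c v)) _).
apply: subset_card_le => c [s [[s_ind s_C s_R] sa sc]].
have s_atom g (t : terms q) : body q g -> atom_has_term g (val t) ->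
    exists e, s t = inl e.
  case: g => [D u|P u1 u2] /= qg.
    by move=> E; move: qg; rewrite -E => /s_C[e]; exists e.
  have [|y1 E1] := mk_term u1; first by left; eexists; [exact: qg|by left].
  have [|y2 E2] := mk_term u2; first by left; eexists; [exact: qg|by right].
  move: qg; rewrite -E1 -E2 => /s_R[e1 [e2 [[s1 s2] _]]].
  by case=> /val_inj ->; [exists e1|exists e2].
have s_ans (t : terms q) i : val t = TVar _ (tnth (avars q) i) ->
    exists2 e, s t = inl e & iint C (tnth a i) = Some e.
  move=> /sa; have [|e Ee] := mk_word K (tnth a i, [::]);
    first by split; [exact: a_ind|].
  have /canon_iint Ee' := Ee.
  by rewrite [iint (completion K) _]/= -[insub _]/(iint C _) Ee' => -[<-]; exists e.
have /choice[s' s'E] : forall t, exists e, s t = inl e.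
  move=> t; case: (pselect (exists2 g, body q g & atom_has_term g (val t))).
    by move=> [g qg gt]; apply: s_atom qg gt.
  (* A term in no atom has only the trivial Gaifman path and is its own root. It is an answer
     variable, since individual names are terms only through atoms. *)
  move=> iso; have [t' [qt' tt' root]] := q_rooted _ (termP t).
  have {tt'} Et : t' = val t.
    have : val t = t' \/ exists2 g, body q g & atom_has_term g (val t).
      elim: tt' => [u u' [P H]|u|u v u' _ [->|?] _ //]; [right|by left|by right].
      by case: H => H; eexists; try exact: H; [left|right].
    by case.
  case: root; rewrite Et => -[w Ew].
    by move=> /tnthP[i Ei]; rewrite Ei in Ew; have [e] := s_ans _ _ Ew; exists e.
  by case: (termP t) => // -[v]; rewrite Ew.
have cE v (t : terms q) : val t = TVar _ (val v) -> c v = inl (s' t).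
  by move=> /sc ->.
have /choice[c' c'E] : forall v, exists e, c v = inl e.
  move=> v; have [|t Et] := mk_term (TVar _ (val v)).
    by right; exists (val v) => //; rewrite (valP v) !orbT.
  by exists (s' t); apply: cE.
exists c'; last by apply: funext => v; rewrite c'E.
exists s'; split; first split.
- move=> t b /s_ind; rewrite s'E [iint (completion K) _]/= -[insub _]/(iint C _).
  by case: (iint C b) => [e [->]|].
- by move=> D t /s_C [e]; rewrite s'E => -[->].
- by move=> P t1 t2 /s_R [e1 [e2 [[]]]]; rewrite !s'E => -[->] [->].
- by move=> i t /s_ans[e]; rewrite s'E => -[->].
- by move=> v t /cE; rewrite c'E => -[].
Qed.

End Matches.

Theorem theorem6 (NC NR NI : Type) (V : eqType)
    (NC_infinite : infinite_set [set: NC])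
    (NR_infinite : infinite_set [set: NR])
    (NI_infinite : infinite_set [set: NI])
    (K : kb NC NR NI) (K_sat : satisfiable K)
    (q : ccq NC NR NI V) (q_exhaustive : exhaustive q) (q_rooted : rooted q)
    (a : (arity q).-tuple NI)
    (a_ind : forall i, Ind (abox K) (tnth a i)) (m : int) :
  certain_answer q K a m <-> answer_interval q (canonical_model K) a m.
Proof.
(* This name ensures that the completion has a non-empty domain. *)
have [a0 _] : [set: NI] !=set0.
  by apply/set0P; apply: contra_notN NI_infinite => /eqP ->.
case: m => [n|n]; last by split.
split=> [certain|canon I IK].
  apply: card_le_trans (certain _ (completion_model K K_sat a0)) _.
  exact: completion_cmatches_le.
by apply: card_le_trans canon _; apply: cmatches_canon_le.
Qed.
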